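(* Let $X\subset\Sigma^{\mathbb Z}$ and $\bar X\subset\bar\Sigma^{\mathbb Z}$ be topologically conjugate synchronized subshifts over finite alphabets, let $\varphi:\bar X\to X$ be a topological conjugacy, and let $L\in\mathbb N$ be such that $[-L,L]$ is a coding window for $\varphi$ and for $\varphi^{-1}$. Let $x\in B^\circ(X)$ be such that $$\lim_{i\to\infty}J_i(x)=\infty ,$$ and set $\bar x=\varphi^{-1}(x)$. Then $\bar x\in B^\circ(\bar X)$ and $$\lim_{i\to\infty}J_i(\bar x)=\infty .$$
   Context: A subshift is a closed shift-invariant subset of $\Sigma^{\mathbb Z}$ ($\Sigma$ finite) with the left shift; a topological conjugacy is a shift-commuting homeomorphism. $[-L,L]$ is a coding window for a shift-commuting continuous map $\psi:Y\to Z$ if there is a block map $\Psi$ with $\psi(y)_i=\Psi(y_{[i-L,i+L]})$ for all $y\in Y$, $i\in\mathbb Z$. $\mathcal L(X)$ is the set of (nonempty, finite) words that appear in points of $X$, and $x_{[i,j]}$ denotes the word $x_i\dots x_j$. A word $c\in\mathcal L(X)$ is synchronizing if, for all words $u,v$ such that $uc\in\mathcal L(X)$ and $cv\in\mathcal L(X)$, one has $ucv\in\mathcal L(X)$; $\mathcal L_{synchro}(X)$ is the set of synchronizing words. A topologically transitive subshift is synchronized if it has a synchronizing word. For a synchronized subshift $X$, $x\in X$, $i\in\mathbb Z$, let $\mathcal J_i(x)=\{j\in(-\infty,i]:x_{[j,i]}\in\mathcal L_{synchro}(X)\}$. Let $B^\circ(X)=\{x\in X:\mathcal J_i(x)\ne\emptyset\text{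 for all }i\in\mathbb Z\}$, and for $x\in B^\circ(X)$ let $J_i(x)=\max\mathcal J_i(x)$. The same notation is used for $\bar X$. *)

(* Defs.v *)
(* MathComp + MathComp-Analysis. *)
From HB Require Import structures.
From mathcomp Require Import all_boot all_order all_algebra.
From mathcomp Require Import mathcomp_extra boolp classical_sets functions.
From mathcomp Require Import topology function_spaces.

Set Implicit Arguments.
Unset Strict Implicit.
Unset Printing Implicit Defensive.

Import Order.TTheory GRing.Theory Num.Theory.

Local Open Scope classical_set_scope.
Local Open Scope ring_scope.

(* Sigma^Z with the product of the discrete topologies. *)
Definition fullshift (Sigma : finType) :=
  {ptws int -> discrete_topology Sigma}.

Section Subshifts.
Variable Sigma : finType.
Implicit Types (X : set (fullshift Sigma)) (x : fullshift Sigma).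
Implicit Types (c u v w : seq Sigma) (i j : int).

Definition shift x : fullshift Sigma := fun i => x (i + 1).

(* Shift-invariance is two-sided: the image of X under the shift is X. *)
Definition subshift X : Prop := closed X /\ shift @` X = X.

(* Transitivity of the one-sided iteration of the shift: between any two
   nonempty relatively open subsets of X some n >= 0 works. For subshifts this
   is the usual condition that for all u, v in L(X) there is a w with
   u w v in L(X). *)
Definition topologically_transitive X : Prop :=
  forall U V : set (fullshift Sigma), open U -> open V ->
    X `&` U !=set0 -> X `&` V !=set0 ->
    exists n : nat, (iter n shift @` (X `&` U)) `&` V !=set0.

(* x_[i,j] = x_i ... x_j, of length j - i + 1; empty when j < i. *)
Definition word x i j : seq Sigma :=
  if i <= j then mkseq (fun k : nat => x (i + k%:Z)) (`|j - i|%N).+1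
  else [::].

Definition language X : set (seq Sigma) :=
  [set w | w <> [::] /\ exists2 x, X x & exists i j, word x i j = w].

Definition synchronizing X : set (seq Sigma) :=
  [set c | language X c /\
    forall u v, language X (u ++ c) -> language X (c ++ v) ->
      language X (u ++ c ++ v)].

Definition synchronized X : Prop :=
  [/\ subshift X, topologically_transitive X & synchronizing X !=set0].

(* The set denoted by a calligraphic J_i(x). *)
Definition calJ X x i : set int :=
  [set j | j <= i /\ synchronizing X (word x j i)].

Definition Bcirc X : set (fullshift Sigma) :=
  [set x | X x /\ forall i, calJ X x i !=set0].

(* J_i(x), the maximum of calJ X x i; the default value 0 is irrelevant as soon
   as calJ X x i is nonempty, see JP below. *)
Definition J X x i : int := xget 0 (calJ X x i `&` ubound (calJ X x i)).

Lemma JP X x i : calJ X x i !=set0 ->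
  calJ X x i (J X x i) /\ forall j, calJ X x i j -> j <= J X x i.
Proof.
move=> [j0 Jj0].
suff [m mJ] : calJ X x i `&` ubound (calJ X x i) !=set0.
  by have := xgetPex 0 (ex_intro _ m mJ); rewrite -/(J X x i) => -[].
have exP : exists n : nat, `[< calJ X x i (i - n%:Z) >].
  exists `|i - j0|%N; apply/asboolP.
  by rewrite gez0_abs ?subr_ge0 ?(proj1 Jj0) // opprB addrC subrK.
case: (ex_minnP exP) => n /asboolP Jn nmin.
exists (i - n%:Z); split=> // j Jj.
have ij : 0 <= i - j by rewrite subr_ge0 (proj1 Jj).
have /nmin : `[< calJ X x i (i - `|i - j|%N%:Z) >].
  by apply/asboolP; rewrite gez0_abs // opprB addrC subrK.
by rewrite -lez_nat gez0_abs // lerBrDl -lerBrDr.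
Qed.

End Subshifts.

(* phi, restricted to Y, is a topological conjugacy from Y onto Z, and psi,
   restricted to Z, is its inverse; the values of phi off Y and of psi off Z
   are irrelevant. *)
Definition topological_conjugacy (A B : finType)
    (Y : set (fullshift A)) (Z : set (fullshift B))
    (phi : fullshift A -> fullshift B) (psi : fullshift B -> fullshift A) :=
  [/\ set_fun Y Z phi /\ set_fun Z Y psi,
      {in Y, cancel phi psi} /\ {in Z, cancel psi phi},
      {within Y, continuous phi} /\ {within Z, continuous psi}
    & {in Y, forall y, phi (shift y) = shift (phi y)}].

(* The block map Psi is total on words; only its values on the words of length
   2L + 1 occurring in points of Y matter. *)
Definition coding_window (A B : finType) (L : nat) (Y : set (fullshift A))
    (psi : fullshift A -> fullshift B) : Prop :=
  exists Psi : seq A -> B, forall y, Y y ->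
    forall i : int, psi y i = Psi (word y (i - L%:Z) (i + L%:Z)).

(* lim_(i -> oo) u_i = oo; the library's filter at +oo needs a field. *)
Definition tends_to_infty (u : int -> int) : Prop :=
  forall M : int, exists N : int, forall i, N <= i -> M <= u i.

(* Main.v *)
(** If [x_[j,i]] is synchronizing for [X], then [(phiV x)_[j-2L,i+2L]] is
    synchronizing for [Xb]: a word is synchronizing exactly when two points that
    share it at the same place can be glued along it, on arbitrarily large finite
    windows. Two points of [Xb] sharing [(phiV x)_[j-2L,i+2L]] have images under
    [phi] that share [x_[j-L,i+L]]; these can be glued, and the image under
    [phiV] of the result glues the original points. Therefore
    [J_(i+2L) (phiV x) >= J_i x - 2L]. *)
Require Import Defs.
From mathcomp Require Import all_boot all_order all_algebra.
From mathcomp Require Import boolp classical_sets functions.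
From mathcomp Require Import topology function_spaces.
From mathcomp Require Import zify.

Set Implicit Arguments.
Unset Strict Implicit.
Unset Printing Implicit Defensive.

Import Order.TTheory GRing.Theory Num.Theory.

Local Open Scope classical_set_scope.
Local Open Scope ring_scope.

Lemma cat_inj (T : Type) (s1 s2 t1 t2 : seq T) :
  size s1 = size s2 -> s1 ++ t1 = s2 ++ t2 -> s1 = s2 /\ t1 = t2.
Proof.
by elim: s1 s2 => [|a s1 IHs] [|b s2] //= [/IHs h] [-> /h[-> ->]].
Qed.

Section Words.
Variable Sigma : finType.
Implicit Types (X : set (fullshift Sigma)) (x y z w : fullshift Sigma).
Implicit Types (i j k : int) (u v c : seq Sigma).

(** Indexing by length makes concatenation an addition of lengths. The case [n = 0] is included: the
    right end is then [i - 1] and the word is empty. *)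
Lemma wordE x i (n : nat) :
  word x i (i + n%:Z - 1) = mkseq (fun k : nat => x (i + k%:Z)) n.
Proof.
rewrite /word; case: n => [|n]; first by rewrite ifF //; lia.
rewrite ifT; last by lia.
by congr mkseq; lia.
Qed.

Lemma size_word x i j : i <= j + 1 -> size (word x i j) = absz (j + 1 - i)%R.
Proof.
move=> ij; have -> : j = i + (absz (j + 1 - i)%R)%:Z - 1 by lia.
by rewrite wordE size_mkseq; lia.
Qed.

Lemma word_eqP x y i j :
  word x i j = word y i j <-> forall k, i <= k <= j -> x k = y k.
Proof.
rewrite /word; case: ifPn => ij; last by split=> // _ k; lia.
split=> [e k ikj|e].
  have := congr1 (nth (x k) ^~ (absz (k - i)%R)) e.
  rewrite !nth_mkseq; try lia.
  by have -> : i + (absz (k - i)%R)%:Z = k by lia.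
by apply/eq_in_map => n; rewrite mem_iota => nlt; apply: e; lia.
Qed.

Lemma word_cat x i j k : i <= j -> j <= k + 1 ->
  word x i (j - 1) ++ word x j k = word x i k.
Proof.
move=> ij jk; have [m jE] : exists m : nat, j = i + m%:Z.
  by exists (absz (j - i)%R); lia.
have [n kE] : exists n : nat, k = i + m%:Z + n%:Z - 1.
  by exists (absz (k + 1 - j)%R); lia.
have -> : word x i k = word x i (i + (m + n)%N%:Z - 1) by congr word; lia.
rewrite kE jE !wordE /mkseq iotaD map_cat add0n 
  -[in iota m n](addn0 m) (iotaDl m 0) -map_comp.
by congr (_ ++ _); apply: eq_map => l /=; congr x; lia.
Qed.

Lemma subshift_translate X x k : subshift X -> X x ->
  X ((fun i => x (i + k)) : fullshift Sigma).
Proof.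
move=> [_ sX] Xx; have shX y : X y -> X (shift y).
  by move=> Xy; rewrite -sX; exists y.
have shVX y : X y -> X ((fun i => y (i - 1)) : fullshift Sigma).
  rewrite -{1}sX => -[z Xz <-].
  by congr X: Xz; apply/funext => i; rewrite /shift subrK.
elim/int_rect: k => [|n IHn|n IHn].
- by congr X: Xx; apply/funext => i; rewrite addr0.
- congr X: (shX _ IHn); apply/funext => i; rewrite /shift; congr x; lia.
- congr X: (shVX _ IHn); apply/funext => i; congr x; lia.
Qed.

Lemma language_word X x i j : X x -> i <= j -> language X (word x i j).
Proof.
move=> Xx ij; split; last by exists x => //; exists i, j.
by move/(congr1 size); rewrite size_word /=; lia.
Qed.

(** Translation invariance frees the position of an occurrence, so that [u ++ c] and [c ++ v] can be
    realized with [c] at the same place. *)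
Lemma language_at X u i : subshift X -> language X u ->
  exists2 x, X x & word x i (i + (size u)%:Z - 1) = u.
Proof.
move=> sX [u0 [x Xx [a [b xu]]]].
have ab : a <= b by move: u0; rewrite -xu /word; case: ifP.
exists ((fun k => x (k + (a - i))) : fullshift Sigma).
  exact: (@subshift_translate X x (a - i)).
rewrite wordE -xu size_word; last by lia.
have {2}-> : b = a + (absz (b + 1 - a)%R)%:Z - 1 by lia.
by rewrite wordE; apply: eq_map => k /=; congr x; lia.
Qed.

(** With [c] at [[j, i]], the words [u] and [v] of the definition are what [y] shows to the left of
    [j] and [z] to the right of [i]; either may be empty ([a = j] or [b = i]). *)
Lemma synchronizingP X x i j : subshift X -> X x -> j <= i ->
  synchronizing X (word x j i) <->
  forall y z, X y -> X z ->
    word y j i = word x j i -> word z j i = word x j i ->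
    forall a b, a <= j -> i <= b ->
    exists w, [/\ X w, word w a i = word y a i & word w j b = word z j b].
Proof.
move=> sX Xx ji; split=> [[_ sync] y z Xy Xz yx zx a b aj ib|glue].
  have ey : word y a (j - 1) ++ word x j i = word y a i.
    by rewrite -yx word_cat //; lia.
  have ez : word x j i ++ word z (i + 1) b = word z j b.
    rewrite -zx -{1}(addrK 1 i) word_cat //; lia.
  have := sync (word y a (j - 1)) (word z (i + 1) b).
  rewrite ey ez => /(_ _ _)/(language_at a sX)[].
  - by apply: language_word => //; lia.
  - by apply: language_word => //; lia.
  move=> w Xw; rewrite size_cat !size_word; try lia.
  have -> : a + (absz (j - 1 + 1 - a)%R + absz (b + 1 - j)%R)%N%:Z - 1 = b by lia.
  move=> ew; exists w; split=> //.
    (* The same word [u ++ c ++ v] is cut after [c] to recover [y], then before [c] to recover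
       [z]. *)
    have := ew; rewrite -ez catA ey -(@word_cat w a (i + 1) b); try lia.
    by rewrite addrK => /cat_inj[]; rewrite ?size_word //; lia.
  have := ew; rewrite -(@word_cat w a j b); try lia.
  by case/cat_inj; rewrite ?size_word //; lia.
split; first exact: language_word.
have sc : size (word x j i) = absz (i + 1 - j)%R by rewrite !size_word; lia.
(* Starting [u ++ c] at [j - size u] and [c ++ v] at [j] puts [c] on [[j, i]] in both points. *)
move=> u v /(language_at (j - (size u)%:Z) sX)[y Xy].
rewrite size_cat sc.
have -> : j - (size u)%:Z + (size u + absz (i + 1 - j)%R)%N%:Z - 1 = i by lia.
move=> ey /(language_at j sX)[z Xz]; rewrite size_cat sc.
have -> : j + (absz (i + 1 - j)%R + size v)%N%:Z - 1 = i + (size v)%:Z by lia.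
move=> ez.
have yx : word y j i = word x j i.
  have := ey; rewrite -(@word_cat y _ j i); try lia.
  by case/cat_inj; rewrite ?size_word //; lia.
have [zx zv] : word z j i = word x j i /\ word z (i + 1) (i + (size v)%:Z) = v.
  have := ez; rewrite -(@word_cat z j (i + 1)); try lia.
  by rewrite addrK => /cat_inj; apply; rewrite !size_word; lia.
have [||w [Xw wy wz]] :=
  glue y z Xy Xz yx zx (j - (size u)%:Z) (i + (size v)%:Z); try lia.
have -> : u ++ word x j i ++ v =
    word w (j - (size u)%:Z) (i + (size v)%:Z).
  rewrite -(@word_cat w _ (i + 1)); try lia.
  rewrite addrK wy ey -catA -{1}zv; congr (_ ++ (_ ++ _)).
  apply/word_eqP => k kb; symmetry; move/word_eqP: wz; apply; lia.
by apply: language_word => //; lia.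
Qed.

End Words.

Lemma coding_window_word (A B : finType) (L : nat) (Y : set (fullshift A))
    (psi : fullshift A -> fullshift B) (y z : fullshift A) (i j : int) :
  coding_window L Y psi -> Y y -> Y z ->
  word y (i - L%:Z) (j + L%:Z) = word z (i - L%:Z) (j + L%:Z) ->
  word (psi y) i j = word (psi z) i j.
Proof.
move=> [Psi psiE] Yy Yz /word_eqP yz; apply/word_eqP => k kij.
rewrite !psiE //; congr Psi; apply/word_eqP => l lk; apply: yz; lia.
Qed.

Lemma synchronizing_conjugacy (A B : finType) (Y : set (fullshift A))
    (Z : set (fullshift B)) (phi : fullshift A -> fullshift B)
    (psi : fullshift B -> fullshift A) (L : nat) (x : fullshift B) (i j : int) :
  subshift Y -> subshift Z -> topological_conjugacy Y Z phi psi ->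
  coding_window L Y phi -> coding_window L Z psi ->
  Z x -> j <= i -> synchronizing Z (word x j i) ->
  synchronizing Y (word (psi x) (j - (2 * L)%N%:Z) (i + (2 * L)%N%:Z)).
Proof.
move=> sY sZ [[phiYZ psiZY] [phiK psiK] _ _] wphi wpsi Zx ji.
move=> /(synchronizingP sZ Zx ji) glue.
have Yx := psiZY _ Zx.
apply/(synchronizingP sY Yx); first by lia.
move=> y z Yy Yz yx zx a b aj ib.
(* Applying [phi] costs [L] on each side. What remains exceeds [[j, i]] by a margin [L], which pays
   for applying [psi] later. *)
have phix t : Y t ->
    word t (j - (2 * L)%N%:Z) (i + (2 * L)%N%:Z) =
      word (psi x) (j - (2 * L)%N%:Z) (i + (2 * L)%N%:Z) ->
    forall k, j - L%:Z <= k <= i + L%:Z -> phi t k = x k.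
  move=> Yt tx; apply/word_eqP; rewrite -[in RHS](psiK x) ?inE //.
  apply: (coding_window_word wphi) => //.
  by congr (_ = _) : tx; congr word; lia.
(* The outer ends are widened by [L] because [psi] on [[a, b]] reads [[a - L, b + L]]. *)
have [||||w [Zw /word_eqP wy /word_eqP wz]] := glue (phi y) (phi z)
    (phiYZ _ Yy) (phiYZ _ Yz) _ _ (a - L%:Z) (b + L%:Z); try lia.
- by apply/word_eqP => k kij; apply: phix => //; lia.
- by apply/word_eqP => k kij; apply: phix => //; lia.
have wy' : forall k, a <= k <= i -> psi w k = y k.
  apply/word_eqP; rewrite -[in RHS](phiK y) ?inE //.
  apply: (coding_window_word wpsi) => //; first exact: phiYZ.
  (* Between [i] and [i + L], [w] is known only through [phi z], but there [phi z] and [phi y] both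
     equal [x]. *)
  apply/word_eqP => k kij; have [ki|ik] := leP k i; first by apply: wy; lia.
  rewrite wz; last by lia.
  by rewrite !phix //; lia.
have wz' : forall k, j <= k <= b -> psi w k = z k.
  apply/word_eqP; rewrite -[in RHS](phiK z) ?inE //.
  apply: (coding_window_word wpsi) => //; first exact: phiYZ.
  apply/word_eqP => k kij; have [jk|kj] := leP j k; first by apply: wz; lia.
  rewrite wy; last by lia.
  by rewrite !phix //; lia.
move/word_eqP: yx => yx; move/word_eqP: zx => zx.
exists (psi w); split; first exact: psiZY.
  (* From [i] to [i + 2L], [psi w] follows [z], which coincides there with [psi x] and hence with
     [y]. *)
  apply/word_eqP => k kij; have [ki|ik] := leP k i; first by apply: wy'; lia.
  by rewrite wz' ?yx ?zx //; lia.
apply/word_eqP => k kij; have [jk|kj] := leP j k; first by apply: wz'; lia.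
by rewrite wy' ?yx ?zx //; lia.
Qed.

Theorem lemma6 (Sigma Sigmab : finType)
    (X : set (fullshift Sigma)) (Xb : set (fullshift Sigmab))
    (sX : synchronized X) (sXb : synchronized Xb)
    (phi : fullshift Sigmab -> fullshift Sigma)
    (phiV : fullshift Sigma -> fullshift Sigmab)
    (phi_conj : topological_conjugacy Xb X phi phiV)
    (L : nat)
    (phi_window : coding_window L Xb phi)
    (phiV_window : coding_window L X phiV)
    (x : fullshift Sigma) (xB : Bcirc X x)
    (Jx : tends_to_infty (J X x)) :
  Bcirc Xb (phiV x) /\ tends_to_infty (J Xb (phiV x)).
Proof.
have [sX' _ _] := sX; have [sXb' _ _] := sXb; have [Xx Jx0] := xB.
(* Starting from [i - 2L] makes the extended word end exactly at [i]. *)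
have calJV i :
    calJ Xb (phiV x) i (J X x (i - (2 * L)%N%:Z) - (2 * L)%N%:Z).
  have [[Ji sync] _] := JP (Jx0 (i - (2 * L)%N%:Z)).
  split; first by lia.
  have := synchronizing_conjugacy sXb' sX' phi_conj phi_window phiV_window Xx
    Ji sync.
  by rewrite subrK.
split.
  split; last by move=> i; eexists; exact: calJV.
  by have [[_ phiVX] _ _ _] := phi_conj; exact: phiVX.
(* [M] is raised by [2L] for the loss at the left end of the word, and [N] for the index
   [i - 2L]. *)
move=> M; have [N JN] := Jx (M + (2 * L)%N%:Z).
exists (N + (2 * L)%N%:Z) => i Ni.
have [_ /(_ _ (calJV i))] := JP (ex_intro _ _ (calJV i)).
have := JN (i - (2 * L)%N%:Z); lia.
Qed.
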